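(* Let $\mathcal{C}$ be a commutative coherent configuration of rank $r$ that realizes $\bigoplus_{i=1}^k\langle\ell_i,m_i,n_i\rangle$, where $k\ge 1$ and all $\ell_i,m_i,n_i$ are positive integers. Then symmetric powers of direct powers of $\mathcal{C}$, i.e. the family $\{\mathrm{Sym}^s(\mathcal{C}^t): s,t\ge 1\}$, prove the bound $$\sum_{i=1}^k (\ell_i m_i n_i)^{\omega_s/3}\le r.$$
   Context: Write $[n]=\{1,\dots,n\}$. A coherent configuration of rank $r$ is a finite set $\mathcal{C}$ (of points) with a partition of $\mathcal{C}^2$ into subsets $R_1,\dots,R_r$ (nonempty, called classes) such that: (1) the diagonal is a union of some of the classes; (2) for each $i\in[r]$ there is $i^*\in[r]$ with $\{(b,a):(a,b)\in R_i\}=R_{i^*}$; (3) there are integers $p^k_{i,j}$ such that for all $i,j,k\in[r]$ and all $(x,y)\in R_k$, $\#\{z\in\mathcal{C}:(x,z)\in R_i,\ (z,y)\in R_j\}=p^k_{i,j}$. It is commutative if $p^k_{i,j}=p^k_{j,i}$ for all $i,j,k$. Three classes $i,j,k$ form a triangle if there exist points $x,y,z$ with $(x,y)\in R_i$, $(y,z)\in R_j$, $(z,x)\in R_k$. $\mathcal{C}$ realizes $\langle\ell,m,n\rangle$ if there are injective functions $\alpha:[\ell]\times[m]\to[r]$, $\beta:[m]\times[n]\to[r]$, $\gamma:[n]\times[\ell]\to[r]$ such that $\alpha(a,b'),\beta(b,c'),\gamma(c,a')$ form a triangle iff $a=a'$, $b=b'$, $c=c'$. $\mathcal{C}$ realizes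 $\bigoplus_i\langle\ell_i,m_i,n_i\rangle$ if there are injective functions $\alpha_i:[\ell_i]\times[m_i]\to[r]$, $\beta_i:[m_i]\times[n_i]\to[r]$, $\gamma_i:[n_i]\times[\ell_i]\to[r]$ such that $\alpha_i(a,b'),\beta_j(b,c'),\gamma_k(c,a')$ form a triangle iff $i=j=k$ and $a=a'$, $b=b'$, $c=c'$. The direct power $\mathcal{C}^t$ is the coherent configuration on the $t$-fold Cartesian power of the point set with classes indexed by $I\in[r]^t$: $((x_j),(y_j))\in R_I$ iff $(x_j,y_j)\in R_{I_j}$ for all $j$. For a coherent configuration $\mathcal{D}$, $\mathrm{Sym}^s\,\mathcal{D}$ is the coherent configuration with the same points as $\mathcal{D}^s$ whose classes are the unions of the classes of $\mathcal{D}^s$ over the orbits of $S_s$ permuting the coordinates of the class indices. s-rank exponent: a third-order tensor over $\mathbb{C}$ is a trilinear form $T=\sum T_{i,j,k}\hat x_i\hat y_j\hat z_k$ in formal variables; its rank is the least number of products of linear forms $\alpha(\hat x)\beta(\hat y)\gamma(\hat z)$ summing to $T$; its s-rank $R_s(T)$ is the minimum rank of a tensor in the same variables having the same set of monomials with nonzero coefficient. $\langle n,n,n\rangle=\sum_{i,j,k\in[n]}\hat x_{i,j}\hat y_{j,k}\hat z_{k,i}$ and $\omega_s=\inf\{\tau\in\mathbb{R}:R_s(\langle n,n,n\rangle)=O(n^\tau)\}$. Meaning of ''prove'': if a commutative coherent configuration $\mathcal{D}$ realizes $\langle L,M,N\rangle$ then $(LMN)^{\omega_s/3}\le \mathrm{rank}(\mathcal{D})$.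 A family $\mathcal{F}$ of commutative coherent configurations proves a bound $P(\omega_s)$ if these inequalities imply it (possibly in the limit over the family): for every real $\tau$ such that $(LMN)^{\tau/3}\le\mathrm{rank}(\mathcal{D})$ for all $\mathcal{D}\in\mathcal{F}$ and all positive integers $L,M,N$ for which $\mathcal{D}$ realizes $\langle L,M,N\rangle$, the statement $P(\tau)$ holds. (In particular $P(\omega_s)$ holds.) *)

(* Defs.v *)
From HB Require Import structures.
From mathcomp Require Import all_boot all_order all_fingroup all_algebra.
Set Implicit Arguments.
Unset Strict Implicit.
Unset Printing Implicit Defensive.
Import Order.TTheory GRing.Theory Num.Theory.

Definition intersection_number (T : finType) (A B : {set T * T}) (x y : T) :
    nat :=
  #|[set z | ((x, z) \in A) && ((z, y) \in B)]|.

(* The classes are indexed by an arbitrary finite type [ccIdx] rather than by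
   {1, ..., r}, so that the index set of a direct power is literally a power.
   [ccP k i j] is the number p^k_{i,j}; it is determined by the classes, since
   these are nonempty. *)
Record coherent_configuration : Type := CoherentConfiguration {
  ccPoint : finType;
  ccIdx : finType;
  ccR : ccIdx -> {set ccPoint * ccPoint};
  ccP : ccIdx -> ccIdx -> ccIdx -> nat;
  ccR_neq0 : forall i, ccR i != set0;
  ccR_partition : forall u, exists! i, u \in ccR i;
  ccR_diag : exists D : {set ccIdx},
    [set u | u.1 == u.2] = \bigcup_(i in D) ccR i;
  ccR_transpose : forall i, exists i',
    [set (u.2, u.1) | u in ccR i] = ccR i';
  ccR_coherent : forall i j k x y, (x, y) \in ccR k ->
    intersection_number (ccR i) (ccR j) x y = ccP k i j
}.

Definition cc_rank (C : coherent_configuration) : nat := #|ccIdx C|.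

Definition cc_commutative (C : coherent_configuration) : Prop :=
  forall i j k : ccIdx C, ccP k i j = ccP k j i.

Definition cc_triangle (C : coherent_configuration) (i j k : ccIdx C) : Prop :=
  exists x y z : ccPoint C,
    [/\ (x, y) \in ccR i, (y, z) \in ccR j & (z, x) \in ccR k].

Definition realizes (C : coherent_configuration) (l m n : nat) : Prop :=
  exists (alpha : 'I_l * 'I_m -> ccIdx C) (beta : 'I_m * 'I_n -> ccIdx C)
         (gamma : 'I_n * 'I_l -> ccIdx C),
    [/\ injective alpha, injective beta, injective gamma &
      forall (a a' : 'I_l) (b b' : 'I_m) (c c' : 'I_n),
        cc_triangle (alpha (a, b')) (beta (b, c')) (gamma (c, a')) <->
        [/\ a = a', b = b' & c = c']].

(* In the last clause [a] and [a'] (and similarly [b], [b'] and [c], [c']) live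
   in different types until [i1 = i2 = i3] is known, so they are compared as
   natural numbers. *)
Definition realizes_sum (C : coherent_configuration) (k : nat)
    (l m n : 'I_k -> nat) : Prop :=
  exists (alpha : forall i, 'I_(l i) * 'I_(m i) -> ccIdx C)
         (beta : forall i, 'I_(m i) * 'I_(n i) -> ccIdx C)
         (gamma : forall i, 'I_(n i) * 'I_(l i) -> ccIdx C),
    [/\ forall i, injective (alpha i),
        forall i, injective (beta i),
        forall i, injective (gamma i) &
      forall (i1 i2 i3 : 'I_k)
        (a : 'I_(l i1)) (a' : 'I_(l i3))
        (b : 'I_(m i2)) (b' : 'I_(m i1))
        (c : 'I_(n i3)) (c' : 'I_(n i2)),
        cc_triangle (alpha i1 (a, b')) (beta i2 (b, c')) (gamma i3 (c, a')) <->
        [/\ i1 = i2 /\ i2 = i3, a = a' :> nat, b = b' :> nat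
          & c = c' :> nat]].

Section DirectPower.
Variables (C : coherent_configuration) (t : nat).

Let T := {ffun 'I_t -> ccPoint C}.
Let K := {ffun 'I_t -> ccIdx C}.

Definition pow_R (I : K) : {set T * T} :=
  [set u : T * T | [forall j, (u.1 j, u.2 j) \in ccR (I j)]].

Definition pow_P (k i j : K) : nat := \prod_h ccP (k h) (i h) (j h).

Lemma pow_R_neq0 I : pow_R I != set0.
Proof.
have [f fP] : exists f : forall j : 'I_t, ccPoint C * ccPoint C,
    forall j, f j \in ccR (I j).
  apply: (@fin_all_exists _ _ (fun j u => u \in ccR (I j))) => j.
  exact/set0Pn/ccR_neq0.
apply/set0Pn; exists ([ffun j => (f j).1], [ffun j => (f j).2]).
by rewrite inE; apply/forallP => j /=; rewrite !ffunE -surjective_pairing.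
Qed.

Lemma pow_R_partition u : exists! I, u \in pow_R I.
Proof.
have [f fP] : exists f : forall j : 'I_t, ccIdx C,
    forall j, (u.1 j, u.2 j) \in ccR (f j).
  apply: (@fin_all_exists _ _ (fun j i => (u.1 j, u.2 j) \in ccR i)) => j.
  by have [i [iP _]] := ccR_partition (u.1 j, u.2 j); exists i.
exists [ffun j => f j]; split.
  by rewrite inE; apply/forallP => j; rewrite ffunE.
move=> I; rewrite inE => /forallP IP; apply/ffunP => j; rewrite ffunE.
have [i [_ iP]] := ccR_partition (u.1 j, u.2 j).
by rewrite -(iP _ (fP j)) (iP _ (IP j)).
Qed.

Lemma pow_R_diag : exists D : {set K},
  [set u | u.1 == u.2] = \bigcup_(i in D) pow_R i.
Proof.
have [D DP] := ccR_diag C.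
exists [set I : K | [forall j, I j \in D]]; apply/setP => u; rewrite inE.
apply/eqP/bigcupP => [u12|[I]].
  have [I [IP _]] := pow_R_partition u; exists I => //.
  rewrite inE; apply/forallP => j.
  have : (u.1 j, u.2 j) \in \bigcup_(i in D) ccR i by rewrite -DP inE /= u12.
  case/bigcupP => i iD ui.
  have [i' [_ i'P]] := ccR_partition (u.1 j, u.2 j).
  move: IP; rewrite inE => /forallP/(_ j)/i'P <-.
  by rewrite (i'P _ ui).
rewrite !inE => /forallP ID /forallP IP; apply/ffunP => j; apply/eqP.
have : (u.1 j, u.2 j) \in [set u | u.1 == u.2].
  by rewrite DP; apply/bigcupP; exists (I j).
by rewrite inE.
Qed.

Lemma pow_R_transpose I : exists I', [set (u.2, u.1) | u in pow_R I] = pow_R I'.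
Proof.
have [f fP] : exists f : forall j : 'I_t, ccIdx C,
    forall j, [set (u.2, u.1) | u in ccR (I j)] = ccR (f j).
  apply: (@fin_all_exists _ _
    (fun j i => [set (u.2, u.1) | u in ccR (I j)] = ccR i)) => j.
  exact: ccR_transpose.
have sw j x y : ((y, x) \in ccR (f j)) = ((x, y) \in ccR (I j)).
  rewrite -fP; apply/imsetP/idP => [[[a b] /= ab [-> ->]] //|xy].
  by exists (x, y).
exists [ffun j => f j]; apply/setP => -[y x].
rewrite inE; apply/imsetP/forallP => [[[a b]] /=|yx /=].
  by rewrite inE => /forallP ab [-> ->] j; rewrite ffunE sw; apply: ab.
exists (x, y) => //; rewrite inE; apply/forallP => j /=.
by rewrite -sw; have := yx j; rewrite ffunE.
Qed.

Lemma pow_R_coherent i j k x y : (x, y) \in pow_R k ->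
  intersection_number (pow_R i) (pow_R j) x y = pow_P k i j.
Proof.
rewrite inE => /forallP /= xyk; rewrite /intersection_number /pow_P.
pose F (h : 'I_t) : {set ccPoint C} :=
  [set z | ((x h, z) \in ccR (i h)) && ((z, y h) \in ccR (j h))].
have -> : \prod_h ccP (k h) (i h) (j h) = \prod_h #|F h|.
  by apply: eq_bigr => h _; rewrite -(ccR_coherent (i h) (j h) (xyk h)).
transitivity #|family (fun h => mem (F h))|; last first.
  by rewrite card_family foldrE big_image.
rewrite cardsE; apply: eq_card => z.
apply/andP/familyP => [[]|zF].
  rewrite !inE => /forallP zi /forallP zj h; rewrite inE /=.
  by apply/andP; split; [exact: zi|exact: zj].
by split; rewrite inE; apply/forallP => h; have := zF h; rewrite inE => /andP[].
Qed.

Definition direct_power : coherent_configuration :=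
  CoherentConfiguration pow_R_neq0 pow_R_partition pow_R_diag pow_R_transpose
    pow_R_coherent.

End DirectPower.

Section Permutation.
Variables (s : nat) (A : finType).

Definition permute (g : 'S_s) (f : {ffun 'I_s -> A}) : {ffun 'I_s -> A} :=
  [ffun j => f (g j)].

Definition sym_orbit (f : {ffun 'I_s -> A}) : {set {ffun 'I_s -> A}} :=
  [set permute g f | g in [set: 'S_s]].

Lemma permuteM g h f : permute g (permute h f) = permute (g * h)%g f.
Proof. by apply/ffunP => j; rewrite !ffunE permM. Qed.

Lemma permute1 f : permute 1%g f = f.
Proof. by apply/ffunP => j; rewrite !ffunE perm1. Qed.

Lemma permuteK g : cancel (permute g) (permute g^-1%g).
Proof. by move=> f; rewrite permuteM mulVg permute1. Qed.

Lemma permuteVK g : cancel (permute g^-1%g) (permute g).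
Proof. by move=> f; rewrite permuteM mulgV permute1. Qed.

Lemma sym_orbitP f f' : reflect (exists g, f' = permute g f) (f' \in sym_orbit f).
Proof.
apply: (iffP imsetP) => [[g _ ->]|[g ->]]; first by exists g.
by exists g.
Qed.

Lemma sym_orbit_refl f : f \in sym_orbit f.
Proof. by apply/sym_orbitP; exists 1%g; rewrite permute1. Qed.

Lemma sym_orbit_permute g f : sym_orbit (permute g f) = sym_orbit f.
Proof.
apply/setP => f'; apply/sym_orbitP/sym_orbitP => -[h ->].
  by exists (h * g)%g; rewrite permuteM.
by exists (h * g^-1)%g; rewrite permuteM mulgKV.
Qed.

End Permutation.

Section SymmetricPower.
Variables (s : nat) (D : coherent_configuration).

Let E := direct_power D s.
Let T := {ffun 'I_s -> ccPoint D}.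
Let K := {ffun 'I_s -> ccIdx D}.

Definition sym_idx : finType :=
  {O : {set K} | O \in [set sym_orbit I | I in [set: K]]}.

Definition sym_R (O : sym_idx) : {set T * T} :=
  \bigcup_(I in val O) ccR (I : ccIdx E).

(* Computed at some pair of points of the (nonempty) class [O]. *)
Definition sym_P (O O1 O2 : sym_idx) : nat :=
  if [pick u in sym_R O] is Some u then
    intersection_number (sym_R O1) (sym_R O2) u.1 u.2
  else 0%N.

Lemma sym_idxE (O : sym_idx) I : I \in val O -> val O = sym_orbit I.
Proof.
have /imsetP[I0 _ ->] := valP O.
by move=> /sym_orbitP[g ->]; rewrite sym_orbit_permute.
Qed.

Lemma sym_idx_exists I : exists O : sym_idx, val O = sym_orbit I.
Proof.
have IP : sym_orbit I \in [set sym_orbit I | I in [set: K]].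
  exact: imset_f.
by exists (exist (fun O : {set K} => is_true (O \in _)) _ IP).
Qed.

Lemma sym_idx_neq0 (O : sym_idx) : exists I, I \in val O.
Proof.
by have /imsetP[I0 _ ->] := valP O; exists I0; apply: sym_orbit_refl.
Qed.

Lemma sym_RP (O : sym_idx) I u :
  u \in ccR (I : ccIdx E) -> (u \in sym_R O) = (I \in val O).
Proof.
move=> uI; apply/bigcupP/idP => [[I' I'O uI']|IO]; last by exists I.
have [I0 [_ I0P]] := ccR_partition u.
by rewrite -(I0P _ uI) (I0P _ uI').
Qed.

Lemma pow_R_permute g (x y : T) (I : K) :
  ((permute g x, permute g y) \in ccR (permute g I : ccIdx E)) =
  ((x, y) \in ccR (I : ccIdx E)).
Proof.
rewrite !inE; apply/forallP/forallP => /= H j; last by rewrite !ffunE.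
by have := H (g^-1%g j); rewrite !ffunE permKV.
Qed.

Lemma sym_R_permute g (x y : T) (O : sym_idx) :
  ((permute g x, permute g y) \in sym_R O) = ((x, y) \in sym_R O).
Proof.
have [I [xyI _]] := ccR_partition ((x, y) : ccPoint E * ccPoint E).
rewrite (sym_RP _ xyI).
have := xyI; rewrite -(pow_R_permute g) => /sym_RP ->.
apply/idP/idP => IO; rewrite (sym_idxE IO).
  by rewrite sym_orbit_permute sym_orbit_refl.
by apply/sym_orbitP; exists g.
Qed.

Lemma sym_R_neq0 O : sym_R O != set0.
Proof.
have [I IO] := sym_idx_neq0 O.
have /set0Pn[u uI] := @ccR_neq0 E I.
by apply/set0Pn; exists u; rewrite (sym_RP _ uI).
Qed.

Lemma sym_R_partition u : exists! O, u \in sym_R O.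
Proof.
have [I [uI _]] := @ccR_partition E u.
have [O OI] := sym_idx_exists I.
exists O; split=> [|O']; rewrite (sym_RP _ uI); first by rewrite OI sym_orbit_refl.
by move=> /sym_idxE O'I; apply: val_inj; rewrite O'I.
Qed.

Lemma sym_R_diag : exists B : {set sym_idx},
  [set u | u.1 == u.2] = \bigcup_(O in B) sym_R O.
Proof.
exists [set O | [exists x, (x, x) \in sym_R O]].
apply/setP => -[x y]; rewrite inE /=; apply/eqP/bigcupP => [->|[O]].
  have [O [OP _]] := sym_R_partition (y, y); exists O => //.
  by rewrite inE; apply/existsP; exists y.
rewrite inE => /existsP[z].
case/bigcupP => I IO zI /bigcupP[I' I'O xyI'].
move: I'O; rewrite (sym_idxE IO) => /sym_orbitP[g I'E].
have [B BP] := ccR_diag E.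
have : (z, z) \in [set u : ccPoint E * ccPoint E | u.1 == u.2] by rewrite inE.
rewrite BP => /bigcupP[J JB zJ].
have [I0 [_ I0P]] := @ccR_partition E (z, z).
have IB : (I : ccIdx E) \in B by rewrite -(I0P _ zI) (I0P _ zJ).
have : (permute g^-1%g x, permute g^-1%g y) \in \bigcup_(i in B) ccR i.
  apply/bigcupP; exists I => //.
  by rewrite -(pow_R_permute g) !permuteVK -I'E.
by rewrite -BP inE /= => /eqP/(can_inj (permuteVK g)).
Qed.

Lemma sym_R_transpose O : exists O', [set (u.2, u.1) | u in sym_R O] = sym_R O'.
Proof.
have [I IO] := sym_idx_neq0 O.
have [I' I'P] := @ccR_transpose E I.
have sw x y : ((y, x) \in ccR I') = ((x, y) \in ccR (I : ccIdx E)).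
  rewrite -I'P; apply/imsetP/idP => [[[a b] /= ab [-> ->]] //|xy].
  by exists (x, y).
have [O' O'E] := sym_idx_exists I'; exists O'; apply/setP => -[y x].
apply/imsetP/bigcupP => [[[a b]] /= /bigcupP[J] JO ab [-> ->]|[J]].
  move: JO; rewrite (sym_idxE IO) => /sym_orbitP[g JE].
  exists (permute g I'); first by rewrite O'E; apply/sym_orbitP; exists g.
  rewrite -[a](permuteVK g) -[b](permuteVK g) pow_R_permute sw.
  by rewrite -(pow_R_permute g) !permuteVK -JE.
rewrite O'E => /sym_orbitP[g ->] yx; exists (x, y) => //.
apply/bigcupP; exists (permute g I).
  by rewrite (sym_idxE IO); apply/sym_orbitP; exists g.
rewrite -[x](permuteVK g) -[y](permuteVK g) pow_R_permute -sw.
by rewrite -(pow_R_permute g) !permuteVK.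
Qed.

Lemma sym_intersection_sum (O1 O2 : sym_idx) (x y : T) (k : K) :
  (x, y) \in ccR (k : ccIdx E) ->
  intersection_number (sym_R O1) (sym_R O2) x y =
  (\sum_(i in val O1) \sum_(j in val O2) ccP (k : ccIdx E) i j)%N.
Proof.
move=> xyk; pose col (u : T * T) : K := odflt k [pick I | u \in ccR (I : ccIdx E)].
have colP u (I : K) : (u \in ccR (I : ccIdx E)) = (I == col u).
  have [I0 [I0P I0u]] := @ccR_partition E u.
  rewrite /col; case: pickP => [J uJ|/(_ I0)]; last by rewrite I0P.
  apply/idP/eqP => [uI|->] //=.
  by rewrite -(I0u _ uI) (I0u _ uJ).
have symP u O : (u \in sym_R O) = (col u \in val O).
  by apply: sym_RP; rewrite colP.
under eq_bigr => i _ do under eq_bigr => j _ do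
  rewrite -(@ccR_coherent E i j k x y xyk) /intersection_number -sum1dep_card.
rewrite /intersection_number -sum1dep_card.
rewrite (partition_big (fun z => col (x, z)) (mem (val O1))) /=; last first.
  by move=> z; rewrite !symP => /andP[].
apply: eq_bigr => i iO1.
rewrite (partition_big (fun z => col (z, y)) (mem (val O2))) /=; last first.
  by move=> z; rewrite !symP => /andP[/andP[]].
apply: eq_bigr => j jO2; apply: eq_bigl => z.
rewrite !symP !colP ![_ == col _]eq_sym.
apply/idP/idP => [/andP[/andP[_ ->] ->] //|/andP[/eqP-> /eqP->]].
by rewrite iO1 jO2 !eqxx.
Qed.

Lemma sym_intersection_permute (O1 O2 : sym_idx) (x y : T) g :
  intersection_number (sym_R O1) (sym_R O2) (permute g x) (permute g y) =
  intersection_number (sym_R O1) (sym_R O2) x y.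
Proof.
rewrite /intersection_number.
rewrite -[in RHS](card_imset _ (can_inj (@permuteK _ _ g))).
apply: eq_card => z; rewrite inE; apply/idP/imsetP => [zP|[z' z'P ->]].
  exists (permute g^-1%g z); last by rewrite permuteVK.
  by rewrite inE -(sym_R_permute g) -(sym_R_permute g _ y) permuteVK.
by move: z'P; rewrite inE !sym_R_permute.
Qed.

Lemma sym_R_coherent i j k x y : (x, y) \in sym_R k ->
  intersection_number (sym_R i) (sym_R j) x y = sym_P k i j.
Proof.
move=> xyk; rewrite /sym_P; case: pickP => [[x' y'] /=|/(_ (x, y))]; last first.
  by rewrite xyk.
case/bigcupP => I' I'k xyI'; case/bigcupP: xyk => I Ik xyI.
move: I'k; rewrite (sym_idxE Ik) => /sym_orbitP[g I'E].
rewrite -(sym_intersection_permute i j x y g).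
move: xyI; rewrite -(pow_R_permute g) -I'E => xyI.
by rewrite (sym_intersection_sum _ _ xyI) (sym_intersection_sum _ _ xyI').
Qed.

Definition symmetric_power : coherent_configuration :=
  CoherentConfiguration sym_R_neq0 sym_R_partition sym_R_diag sym_R_transpose
    sym_R_coherent.

End SymmetricPower.

(* Imported only here because classical sets shadow the notations for finite
   sets used above. *)
From mathcomp Require Import all_classical all_reals all_analysis.
From mathcomp Require Import complex.
Import numFieldNormedType.Exports.

Local Open Scope ring_scope.

Section Tensor.
Variables (R : realType) (X Y Z : finType).

(* A third-order tensor over the complex numbers, in variables indexed by
   [X], [Y] and [Z], is given by its coefficients. *)
Definition tensor : Type := X -> Y -> Z -> R[i].

Definition sum_of_products (T : tensor) (t : nat) : Prop :=
  exists (u : 'I_t -> X -> R[i]) (v : 'I_t -> Y -> R[i])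
         (w : 'I_t -> Z -> R[i]),
    forall x y z, T x y z = \sum_(h < t) u h x * v h y * w h z.

Lemma sum_of_products_exists (T : tensor) : exists t, `[< sum_of_products T t >].
Proof.
pose e (h : 'I_#|{: X * Y * Z}|) := enum_val h.
exists #|{: X * Y * Z}|; apply/asboolP.
exists (fun h x => T (e h).1.1 (e h).1.2 (e h).2 *+ (x == (e h).1.1)),
  (fun h y => (y == (e h).1.2)%:R), (fun h z => (z == (e h).2)%:R) => x y z.
rewrite (bigD1 (enum_rank (x, y, z))) //= /e enum_rankK /= !eqxx !mulr1.
rewrite big1 ?addr0 // => h hxyz.
have : (x, y, z) != enum_val h.
  by apply: contraNneq hxyz => ->; rewrite enum_valK.
case: (enum_val h) => -[x' y'] z' /=; rewrite !xpair_eqE !negb_and.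
by case/orP=> [/orP[]|] /negPf ->; rewrite ?(mulr0n, mulr0, mul0r).
Qed.

Definition tensor_rank (T : tensor) : nat := ex_minn (sum_of_products_exists T).

Definition same_support (T T' : tensor) : Prop :=
  forall x y z, (T x y z != 0) = (T' x y z != 0).

Lemma same_support_exists (T : tensor) : exists t,
  `[< exists T' : tensor, same_support T T' /\ tensor_rank T' = t >].
Proof. by exists (tensor_rank T); apply/asboolP; exists T. Qed.

Definition s_rank (T : tensor) : nat := ex_minn (same_support_exists T).

End Tensor.

Definition matmul_tensor (R : realType) (n : nat) :
    tensor R ('I_n * 'I_n)%type ('I_n * 'I_n)%type ('I_n * 'I_n)%type :=
  fun x y z => [&& x.2 == y.1, y.2 == z.1 & z.2 == x.1]%:R.
Arguments matmul_tensor R n : clear implicits.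

Definition omega_s (R : realType) : R :=
  inf [set tau : R |
    (fun n : nat => (s_rank (matmul_tensor R n))%:R : R) =O_\oo
    (fun n : nat => (n%:R : R) `^ tau)]%classic.

Definition rank_inequalities (R : realType)
    (F : coherent_configuration -> Prop) (tau : R) : Prop :=
  forall D, F D -> forall L M N : nat, (0 < L)%N -> (0 < M)%N -> (0 < N)%N ->
    realizes D L M N -> ((L * M * N)%N%:R : R) `^ (tau / 3) <= (cc_rank D)%:R.

(* The content is the implication for every real [tau]; the last clause is its
   instance at [omega_s R], whose inequalities hold for every commutative
   coherent configuration. *)
Definition proves_bound (R : realType)
    (F : coherent_configuration -> Prop) (P : R -> Prop) : Prop :=
  [/\ forall D, F D -> cc_commutative D,
      forall tau : R, rank_inequalities F tau -> P tau
    & P (omega_s R)].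

Definition symmetric_powers_of_direct_powers (C D : coherent_configuration) :
    Prop :=
  exists s t : nat, [/\ (0 < s)%N, (0 < t)%N &
    D = symmetric_power s (direct_power C t)].

(* Main.v *)
Require Import Defs.
From mathcomp Require Import all_boot all_order all_fingroup all_algebra.
From mathcomp Require Import all_classical all_reals all_analysis.
From mathcomp Require Import complex.
Set Implicit Arguments.
Unset Strict Implicit.
Unset Printing Implicit Defensive.
Import Order.TTheory GRing.Theory Num.Theory.
Local Open Scope ring_scope.

(** Let w_i = (l_i m_i n_i)^(tau/3).  The power C^t realizes the direct sum of
    the blocks indexed by the words I in [k]^t, the block of I having
    dimensions prod_j l_(I j), prod_j m_(I j), prod_j n_(I j).  Words with the
    same letter counts give blocks of the same dimensions, so if s words have
    given counts, then C^t realizes s copies of a single <L, M, N>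
    ([direct_power_realizes_copies]).  In Sym^s(C^t), using copy j at
    coordinate j turns these s disjoint copies into one <L^s, M^s, N^s>: a
    permutation of the coordinates is detected because triangles never mix
    copies ([symmetric_power_realizes]).

    A symmetric power has few classes: the orbits of S_s on words of length s
    over rho letters are multisets, and for s <= rho there are at most
    (2 rho)^s / s! of them, hence at most (8 rho / s)^s.  The inequality
    assumed for Sym^s(C^t) is therefore, after an s-th root,
    s (LMN)^(tau/3) <= 8 r^t ([copies_bound]).  The left side is the sum of
    prod_j w_(I j) over the words I with the given counts, and there are at
    most (t+1)^k choices of counts, so (sum_i w_i)^t <= 8 (t+1)^k r^t for all
    t >= 1.  A polynomial factor cannot compensate an exponential one, so
    sum_i w_i <= r ([sum_bound]).

    That omega_s itself satisfies the assumed inequalities is a fact about any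
    commutative coherent configuration D.  The adjacency matrices A_i of D
    commute and are normal, so they are simultaneously diagonalizable, and
    tr(A_i A_j A_k), which counts the triangles of type (i, j, k), becomes a
    sum of products of characters of the adjacency algebra.  Distinct
    characters are linearly independent, so at most rank(D) products suffice
    ([triangle_tensor]).  Restricting this tensor to the classes used by a
    realization of <L, M, N> gives a tensor of rank at most rank(D) with the
    support of <L, M, N>.  Multiplying its three cyclic rotations and taking
    powers bounds the s-rank of <q^e, q^e, q^e>, where q = LMN, by
    rank(D)^(3e), whence q^(omega_s/3) <= rank(D)
    ([omega_s_rank_inequality]). *)

(** * Characters of a finite-dimensional commutative algebra *)

Section Characters.
Variables (K : fieldType) (I : finType) (p : I -> I -> I -> K) (e : I -> K).

(** The algebra has basis [I], structure constants [p k i j] (the coefficient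
    of [k] in the product of [i] and [j]) and unit [e]; a character is recorded
    by its values on the basis. *)
Definition is_character (x : {ffun I -> K}) : Prop :=
  \sum_i e i * x i = 1 /\ forall i j, x i * x j = \sum_k p k i j * x k.

(** The functions on characters that come from evaluation at an element of the
    algebra. *)
Definition algebra_function (f : {ffun I -> K} -> K) : Prop :=
  exists c : I -> K, forall x, is_character x -> f x = \sum_i c i * x i.

Lemma algebra_function_affine a b i :
  algebra_function (fun x : {ffun I -> K} => a * x i + b).
Proof.
exists (fun j => a *+ (j == i) + b * e j) => x [x1 _].
under eq_bigr do rewrite mulrDl -mulrA.
rewrite big_split /= -mulr_sumr x1 mulr1 (bigD1 i) //= eqxx big1 ?addr0 //.
by move=> j /negPf ->; rewrite mul0r.
Qed.

Lemma algebra_function_mul f g : algebra_function f -> algebra_function g ->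
  algebra_function (fun x => f x * g x).
Proof.
move=> [c cP] [d dP]; exists (fun k => \sum_i \sum_j c i * d j * p k i j).
move=> x xP.
rewrite (cP x xP) (dP x xP) mulr_suml.
under [RHS]eq_bigr do rewrite mulr_suml; rewrite exchange_big /=.
apply: eq_bigr => i _; rewrite mulr_sumr.
under [RHS]eq_bigr do rewrite mulr_suml; rewrite exchange_big /=.
apply: eq_bigr => j _; rewrite mulrACA xP.2 mulr_sumr.
by apply: eq_bigr => k _; rewrite mulrA.
Qed.

(** Lagrange interpolation: the product over the x1 in xs of the functions
    (x i - x1 i) / (x0 i - x1 i), with i a coordinate where x0 and x1 differ.
    This stays within the functions given by the algebra since these are
    closed under products. *)
Lemma characters_separated x0 (xs : seq {ffun I -> K}) :
    is_character x0 -> x0 \notin xs ->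
  exists f, [/\ algebra_function f, f x0 = 1 & forall x, x \in xs -> f x = 0].
Proof.
move=> x0P; elim: xs => [|x1 xs IH].
  move=> _; exists (fun=> 1); split=> //.
  by exists e => x [].
rewrite inE negb_or => /andP[x01 /IH [f [fP f0 fxs]]].
have [i x01i] : exists i, x0 i != x1 i.
  apply/existsP; rewrite -negb_forall; apply: contraNN x01 => /forallP x01.
  by apply/eqP/ffunP => i; apply/eqP.
rewrite -subr_eq0 in x01i; pose a := (x0 i - x1 i)^-1.
exists (fun x : {ffun I -> K} => (a * x i + - (a * x1 i)) * f x); split.
- exact: algebra_function_mul (algebra_function_affine _ _ _) fP.
- by rewrite f0 mulr1 -mulrBr mulVf.
- move=> x; rewrite inE => /predU1P[->|/fxs ->]; last by rewrite mulr0.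
  by rewrite subrr mul0r.
Qed.

(** The interpolating elements of the algebra form a matrix that is a left
    inverse of the matrix of values of the characters, so the number of
    characters is at most the dimension. *)
Lemma size_characters (xs : seq {ffun I -> K}) :
  uniq xs -> {in xs, forall x, is_character x} -> (size xs <= #|I|)%N.
Proof.
move=> xs_uniq xsP; pose X (h : 'I_(size xs)) := tnth (in_tuple xs) h.
have /boolp.choice[c cP] : forall h, exists c : I -> K,
    forall h', \sum_i c i * X h' i = (h == h')%:R.
  move=> h.
  have XP h' : is_character (X h') by apply: xsP; apply: mem_tnth.
  have Xrem : X h \notin rem (X h) xs by rewrite mem_rem_uniq // inE eqxx.
  have [f [[c cP] fh f0]] := characters_separated (XP h) Xrem.
  exists c => h'.
  rewrite -cP //; have [<-//|hh'] := eqVneq h h'.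
  apply: f0; rewrite mem_rem_uniq // inE mem_tnth andbT.
  apply: contraNneq hh' => hh'; apply/eqP/val_inj/eqP.
  rewrite /X !(tnth_nth (X h)) in hh'.
  by rewrite -(nth_uniq (X h) _ _ xs_uniq) ?ltn_ord //= hh'.
pose M := \matrix_(h < size xs, i < #|I|) c h (enum_val i).
pose D := \matrix_(i < #|I|, h < size xs) X h (enum_val i).
have MD : M *m D = 1%:M.
  apply/matrixP => h h'; rewrite !mxE -cP.
  under eq_bigr do rewrite !mxE.
  by rewrite [RHS](reindex _ (onW_bij _ (enum_val_bij I))).
by rewrite -[leqLHS](@mxrank1 K) -MD mulmx_max_rank.
Qed.

(** Equal characters can be merged into one term with a multiplicity; the
    distinct ones number at most [#|I|], and null terms fill the remaining
    indices. *)
Lemma sum_over_characters (H : finType) (d : H -> {ffun I -> K}) :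
    (forall h, is_character (d h)) ->
  exists (x : 'I_#|I| -> {ffun I -> K}) (w : 'I_#|I| -> K), forall i j k,
    \sum_h d h i * d h j * d h k = \sum_s w s * x s i * x s j * x s k.
Proof.
move=> dP; pose xs := undup (codom d).
have s_le : (size xs <= #|I|)%N.
  apply: size_characters; first exact: undup_uniq.
  by move=> x; rewrite mem_undup => /codomP[h ->].
pose x0 : {ffun I -> K} := [ffun=> 0].
exists (fun s => nth x0 xs s),
  (fun s => (\sum_(h | d h == nth x0 xs s) 1) *+ (s < size xs)%N) => i j k.
transitivity (\sum_(x <- xs) (\sum_(h | d h == x) 1) * x i * x j * x k).
  rewrite (eq_bigr (fun h => \sum_(x <- xs | d h == x) x i * x j * x k)) => [|h _].
    rewrite (exchange_big_dep xpredT) //=.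
    apply: eq_bigr => x _; rewrite -!mulrA mulr_suml.
    by apply: eq_bigr => h _; rewrite mul1r.
  rewrite (eq_bigl (fun x => x == d h)); last by move=> x; rewrite eq_sym.
  rewrite -big_filter filter_pred1_uniq ?undup_uniq //; first by rewrite big_seq1.
  by rewrite mem_undup codom_f.
rewrite (big_nth x0) -(big_mkord xpredT (fun s =>
  (\sum_(h | d h == nth x0 xs s) 1) *+ (s < size xs)%N * nth x0 xs s i *
  nth x0 xs s j * nth x0 xs s k)).
rewrite (big_cat_nat _ s_le) //= [X in _ = _ + X]big_nat [X in _ = _ + X]big1.
  rewrite addr0 big_nat [RHS]big_nat; apply: eq_bigr => s /andP[_ ->].
  by rewrite mulr1n.
by move=> s /andP[le_s _]; rewrite ltnNge le_s /= mulr0n !mul0r.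
Qed.

End Characters.

(** * The adjacency algebra and the triangle tensor *)

Section AdjacencyAlgebra.
Variables (F : numClosedFieldType) (C : coherent_configuration).

Lemma cc_class_inj (i j : ccIdx C) u : u \in ccR i -> u \in ccR j -> i = j.
Proof.
by have [k [_ kP]] := ccR_partition u; move=> /kP <- /kP <-.
Qed.

Definition adjacency (i : ccIdx C) : 'M[F]_#|ccPoint C| :=
  \matrix_(x, y) ((enum_val x, enum_val y) \in ccR i)%:R.

Lemma adjacency_mul i j :
  adjacency i *m adjacency j = \sum_k (ccP k i j)%:R *: adjacency k.
Proof.
apply/matrixP => x y; rewrite !mxE summxE.
have [k [xyk _]] := ccR_partition (enum_val x, enum_val y).
rewrite [RHS](bigD1 k) //= [X in _ = _ + X]big1 => [|k' /negPf k'k]; last first.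
  rewrite !mxE; case: (boolP (_ \in ccR k')) => [|_]; last by rewrite mulr0.
  by move=> /cc_class_inj/(_ xyk)/eqP; rewrite k'k.
rewrite !mxE xyk mulr1 addr0 -(ccR_coherent _ _ xyk) /intersection_number.
rewrite -sum1dep_card natr_sum [RHS]big_mkcond /=.
rewrite [RHS](reindex _ (onW_bij _ (enum_val_bij (ccPoint C)))) /=.
apply: eq_bigr => z _; rewrite !mxE.
by do 2!case: (_ \in _); rewrite /= ?mulr1 ?mulr0 ?mul0r.
Qed.

Lemma adjacency_one : exists D : {set ccIdx C}, 1%:M = \sum_(i in D) adjacency i.
Proof.
have [D DP] := ccR_diag C; exists D; apply/matrixP => x y; rewrite !mxE summxE.
have [k [xyk _]] := ccR_partition (enum_val x, enum_val y).
have -> : (x == y) = (k \in D).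
  rewrite -(inj_eq enum_val_inj).
  transitivity ((enum_val x, enum_val y) \in \bigcup_(i in D) ccR i).
    by rewrite -DP inE.
  apply/bigcupP/idP => [[i iD /cc_class_inj/(_ xyk) <-]//|kD].
  by exists k.
have adjE i : adjacency i x y = (i == k)%:R.
  rewrite mxE; congr ((nat_of_bool _)%:R).
  by apply/idP/eqP => [/cc_class_inj/(_ xyk)|->].
under eq_bigr do rewrite adjE.
have [kD|kD] := boolP (k \in D).
  by rewrite (bigD1 k) //= eqxx big1 ?addr0 // => i /andP[_ /negPf ->].
by rewrite big1 // => i iD; case: eqP => // ik; rewrite -ik iD in kD.
Qed.

(** The transpose of an adjacency matrix is an adjacency matrix, and these
    commute. *)
Lemma adjacency_normal i : cc_commutative C -> adjacency i \is normalmx.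
Proof.
move=> hcomm; have [i' i'P] := ccR_transpose i.
have adjT : map_mx Num.Def.conjC (adjacency i)^T = adjacency i'.
  apply/matrixP => x y; rewrite !mxE conjC_nat -i'P.
  congr ((nat_of_bool _)%:R).
  apply/idP/imsetP => [yx|[[a b] /= ab [-> ->]] //].
  by exists (enum_val y, enum_val x).
apply/normalmxP; rewrite adjT !adjacency_mul.
by apply: eq_bigr => k _; rewrite hcomm.
Qed.

Lemma adjacency_diagonal : cc_commutative C ->
  exists2 P, P \in unitmx &
    exists d : ccIdx C -> 'rV[F]_#|ccPoint C|,
      forall i, adjacency i = invmx P *m diag_mx (d i) *m P.
Proof.
move=> hcomm.
have /codiagonalizableP[P Punit /allP PP] :
    {in codom adjacency &, forall A B, comm_mx A B} /\
    {in codom adjacency, forall A, diagonalizable A}.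
  split=> [_ _ /codomP[i ->] /codomP[j ->]|_ /codomP[i ->]].
    by rewrite /comm_mx !adjacency_mul; apply: eq_bigr => k _; rewrite hcomm.
  have /orthomx_spectralP Ai := adjacency_normal i hcomm.
  exists (spectralmx (adjacency i)); first exact: spectral_unit.
  apply/similar_diagPex; exists (spectral_diag (adjacency i)).
  apply/similarLR; rewrite ?spectral_unit //.
  by rewrite conjVmx ?spectral_unit.
exists P => //.
have /boolp.choice[d dP] : forall i, exists D : 'rV_#|ccPoint C|,
    adjacency i = invmx P *m diag_mx D *m P.
  move=> i; have /similar_diagPex[D /similarLR] := PP _ (codom_f adjacency i).
  by move=> /(_ Punit); rewrite conjVmx // => iD; exists D.
by exists d.
Qed.

(** The trace is the number of triangles, which is nonzero in characteristic
    zero exactly when there is one. *)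
Lemma trace_adjacency_neq0 i j k :
  \tr (adjacency i *m adjacency j *m adjacency k) != 0 <-> cc_triangle i j k.
Proof.
pose t (x z y : 'I_#|ccPoint C|) : nat := (((enum_val x, enum_val y) \in ccR i) *
  ((enum_val y, enum_val z) \in ccR j) * ((enum_val z, enum_val x) \in ccR k))%N.
have -> : \tr (adjacency i *m adjacency j *m adjacency k) =
    (\sum_x \sum_z \sum_y t x z y)%N%:R.
  rewrite natr_sum; apply: eq_bigr => x _; rewrite mxE natr_sum.
  apply: eq_bigr => z _; rewrite mxE natr_sum mulr_suml.
  by apply: eq_bigr => y _; rewrite !mxE -!natrM.
rewrite pnatr_eq0; split.
  rewrite sum_nat_eq0 => /forallPn[x]; rewrite sum_nat_eq0 => /forallPn[z].
  rewrite sum_nat_eq0 => /forallPn[y]; rewrite !muln_eq0 !eqb0 !negb_or !negbK.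
  case/andP => /andP[xy yz] zx.
  by exists (enum_val x), (enum_val y), (enum_val z).
move=> [x [y [z [xy yz zx]]]].
rewrite sum_nat_eq0; apply/forallPn; exists (enum_rank x).
rewrite sum_nat_eq0; apply/forallPn; exists (enum_rank z).
rewrite sum_nat_eq0; apply/forallPn; exists (enum_rank y).
by rewrite /t !enum_rankK xy yz zx.
Qed.

(** The diagonal entries at a fixed position, after simultaneous
    diagonalization, form a character of the adjacency algebra.  The trace
    tensor is the sum of the cubes of these characters, one for each point of
    [C]; only merging equal characters brings the number of terms down to the
    rank of [C]. *)
Lemma triangle_tensor : cc_commutative C ->
  exists u v w : 'I_(cc_rank C) -> ccIdx C -> F, forall i j k,
    \sum_s u s i * v s j * w s k != 0 <-> cc_triangle i j k.
Proof.
move=> hcomm; have [P Punit [d dP]] := adjacency_diagonal hcomm.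
have diag_inj : injective (fun D : 'rV[F]_#|ccPoint C| => invmx P *m diag_mx D *m P).
  apply: (can_inj (g := fun A => \row_h (P *m A *m invmx P) h h)) => D.
  apply/rowP => h; rewrite mxE !mulmxA mulmxV // mul1mx mulmxK //.
  by rewrite mxE eqxx.
have diagM D D' : (invmx P *m diag_mx D *m P) *m (invmx P *m diag_mx D' *m P)
    = invmx P *m diag_mx (\row_h (D 0 h * D' 0 h)) *m P.
  rewrite -mulmx_diag !mulmxA; congr (_ *m _ *m _).
  by rewrite mulmxK.
have diagS (I : finType) (Q : pred I) (a : I -> F) (D : I -> 'rV[F]_#|ccPoint C|) :
    \sum_(k | Q k) a k *: (invmx P *m diag_mx (D k) *m P) =
    invmx P *m diag_mx (\sum_(k | Q k) a k *: D k) *m P.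
  rewrite linear_sum mulmx_sumr mulmx_suml; apply: eq_bigr => k _.
  by rewrite linearZ -scalemxAr -scalemxAl.
have [D oneD] := adjacency_one.
pose x h : {ffun ccIdx C -> F} := [ffun i => d i 0 h].
have xP h : is_character (fun k i j => (ccP k i j)%:R) (fun i => (i \in D)%:R) (x h).
  split.
    have : invmx P *m diag_mx (const_mx 1) *m P =
        invmx P *m diag_mx (\sum_(i in D) 1 *: d i) *m P.
      rewrite -diagS diag_const_mx mulmx1 mulVmx // oneD.
      by apply: eq_bigr => i _; rewrite scale1r dP.
    move=> /diag_inj/rowP/(_ h); rewrite [LHS]mxE => oneE.
    rewrite [RHS]oneE summxE [RHS]big_mkcond /=; apply: eq_bigr => i _.
    by rewrite mxE ffunE; case: ifP => _; rewrite ?mul1r ?mul0r.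
  move=> i j; have := adjacency_mul i j; rewrite !dP diagM.
  under eq_bigr do rewrite dP.
  rewrite diagS => /diag_inj/rowP/(_ h); rewrite mxE summxE !ffunE => ->.
  by apply: eq_bigr => k _; rewrite mxE ffunE.
have [y [w yw]] := sum_over_characters xP.
exists (fun s i => w s * y s i), y, y => i j k.
rewrite -trace_adjacency_neq0 -yw !dP !diagM mxtrace_mulC mulmxA mulmxV //.
rewrite mul1mx mxtrace_diag; under eq_bigr do rewrite !ffunE.
by under [X in _ <-> is_true (X != 0)]eq_bigr do rewrite !mxE.
Qed.

End AdjacencyAlgebra.

(** * The support rank of matrix multiplication *)

Section SupportRank.
Variable K : fieldType.

(** Some tensor with the support of matrix multiplication, of format
    (A x B) * (B x C) * (C x A), is a sum of products indexed by [H].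
    Arbitrary finite index types make Kronecker products immediate. *)
Definition has_support_rank (A B C H : finType) : Prop :=
  exists (u : H -> A * B -> K) (v : H -> B * C -> K) (w : H -> C * A -> K),
    forall x y z, (\sum_h u h x * v h y * w h z != 0) =
      [&& x.2 == y.1, y.2 == z.1 & z.2 == x.1].

Lemma has_support_rank_rot A B C H :
  has_support_rank A B C H -> has_support_rank B C A H.
Proof.
move=> [u [v [w uvwP]]]; exists v, w, u => x y z.
rewrite [RHS]andbA [RHS]andbC -uvwP.
by under eq_bigr do rewrite mulrC mulrA.
Qed.

Lemma has_support_rank_mul A B C H A' B' C' H' :
  has_support_rank A B C H -> has_support_rank A' B' C' H' ->
  has_support_rank (A * A')%type (B * B')%type (C * C')%type (H * H')%type.
Proof.
move=> [u [v [w uvwP]]] [u' [v' [w' uvwP']]].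
pose prod2 (X Y X' Y' : finType) (f : H -> X * Y -> K) (f' : H' -> X' * Y' -> K)
  (h : H * H') (x : (X * X') * (Y * Y')) :=
  f h.1 (x.1.1, x.2.1) * f' h.2 (x.1.2, x.2.2).
exists (prod2 _ _ _ _ u u'), (prod2 _ _ _ _ v v'), (prod2 _ _ _ _ w w').
move=> [[a a'] [b b']] [[b1 b1'] [c c']] [[c1 c1'] [a1 a1']] /=.
transitivity ((\sum_h u h (a, b) * v h (b1, c) * w h (c1, a1)) *
  (\sum_h u' h (a', b') * v' h (b1', c') * w' h (c1', a1')) != 0).
  congr (_ != 0); rewrite big_distrlr /= pair_bigA /=.
  by apply: eq_bigr => h _; rewrite /prod2 /= [RHS]mulrACA (mulrACA (u _ _)).
rewrite mulf_eq0 negb_or uvwP uvwP' /= !xpair_eqE.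
by do 6!case: (_ == _).
Qed.

Lemma has_support_rank_ord A B C H l m n : has_support_rank A B C H ->
    (l <= #|A|)%N -> (m <= #|B|)%N -> (n <= #|C|)%N ->
  has_support_rank 'I_l 'I_m 'I_n 'I_#|H|.
Proof.
move=> [u [v [w uvwP]]] lA mB nC.
pose i (X : finType) k (le_k : (k <= #|X|)%N) (a : 'I_k) : X :=
  enum_val (widen_ord le_k a).
have i_inj X k le_k : injective (@i X k le_k).
  by move=> a b /enum_val_inj/(congr1 val)/= ab; apply: val_inj.
exists (fun h x => u (enum_val h) (i _ _ lA x.1, i _ _ mB x.2)),
  (fun h y => v (enum_val h) (i _ _ mB y.1, i _ _ nC y.2)),
  (fun h z => w (enum_val h) (i _ _ nC z.1, i _ _ lA z.2)) => x y z.
rewrite -(inj_eq (i_inj _ _ mB)) -(inj_eq (i_inj _ _ nC)) -(inj_eq (i_inj _ _ lA)).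
rewrite -[RHS](uvwP (_, _) (_, _) (_, _)).
by rewrite [in RHS](reindex _ (onW_bij _ (enum_val_bij H))).
Qed.

Definition mm_support_rank (l m n t : nat) := has_support_rank 'I_l 'I_m 'I_n 'I_t.

Lemma mm_support_rank_mul l m n t l' m' n' t' :
  mm_support_rank l m n t -> mm_support_rank l' m' n' t' ->
  mm_support_rank (l * l') (m * m') (n * n') (t * t').
Proof.
move=> S S'; have := has_support_rank_mul S S'.
move/(@has_support_rank_ord _ _ _ _ (l * l') (m * m') (n * n')).
by rewrite !card_prod !card_ord => /(_ (leqnn _) (leqnn _) (leqnn _)).
Qed.

Lemma mm_support_rank_leq l m n l' m' n' t : mm_support_rank l m n t ->
  (l' <= l)%N -> (m' <= m)%N -> (n' <= n)%N -> mm_support_rank l' m' n' t.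
Proof.
by move=> S; have := has_support_rank_ord S; rewrite !card_ord; apply.
Qed.

(** The Kronecker product of a tensor with its two cyclic rotations is of
    square format. *)
Lemma mm_support_rank_cube l m n t : mm_support_rank l m n t ->
  mm_support_rank (l * m * n) (l * m * n) (l * m * n) (t ^ 3).
Proof.
move=> S; have S1 := has_support_rank_rot S; have S2 := has_support_rank_rot S1.
have := mm_support_rank_mul (mm_support_rank_mul S S1) S2.
have -> : (t * t * t = t ^ 3)%N by rewrite !expnSr mul1n.
have -> : (m * n * l = l * m * n)%N by rewrite mulnC mulnA.
by have -> : (n * l * m = l * m * n)%N by rewrite -mulnA mulnC.
Qed.

Lemma mm_support_rank_exp q t e : mm_support_rank q q q t ->
  mm_support_rank (q ^ e) (q ^ e) (q ^ e) (t ^ e).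
Proof.
move=> S; elim: e => [|e IH]; last by rewrite !expnS; apply: mm_support_rank_mul.
exists (fun _ _ => 1), (fun _ _ => 1), (fun _ _ => 1) => -[a b] [b' c] [c' a'] /=.
by rewrite big_ord1 !mulr1 oner_neq0 !ord1.
Qed.

End SupportRank.

(** * The exponent of s-rank *)

Lemma s_rank_leq (R : realType) n t :
  mm_support_rank R[i] n n n t -> (s_rank (matmul_tensor R n) <= t)%N.
Proof.
move=> [u [v [w uvwP]]].
pose T : tensor R _ _ _ := fun x y z => \sum_h u h x * v h y * w h z.
have TP : same_support (matmul_tensor R n) T.
  by move=> x y z; rewrite /T uvwP /matmul_tensor pnatr_eq0 eqb0 negbK.
apply: (@leq_trans (tensor_rank T)).
  rewrite /s_rank; case: ex_minnP => s _; apply.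
  by apply/boolp.asboolP; exists T.
rewrite /tensor_rank; case: ex_minnP => s _; apply.
by apply/boolp.asboolP; exists u, v, w.
Qed.

Lemma realizes_support_rank (F : numClosedFieldType) D L M N :
  cc_commutative D -> realizes D L M N -> mm_support_rank F L M N (cc_rank D).
Proof.
move=> hcomm [alpha [beta [gamma [_ _ _ abcP]]]].
have [u [v [w uvwP]]] := triangle_tensor F hcomm.
exists (fun s x => u s (alpha x)), (fun s y => v s (beta y)), (fun s z => w s (gamma z)).
move=> [a b'] [b c'] [c a'] /=; apply/idP/and3P.
  by move=> /uvwP/abcP[-> -> ->].
move=> [/eqP bb' /eqP cc' /eqP aa'].
by apply/uvwP/abcP.
Qed.

(** For q^(e-1) < n <= q^e, the s-rank of <n, n, n> is at most
    t^e = t (q^(e-1))^tau <= t n^tau. *)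
Lemma omega_s_le (R : realType) q t (tau : R) :
    (1 < q)%N -> mm_support_rank R[i] q q q t -> 0 <= tau -> t%:R = q%:R `^ tau ->
  omega_s R <= tau.
Proof.
move=> q1 S tau0 tq.
have q0 : (0 : R) < q%:R by rewrite ltr0n ltnW.
have t0 : (0 : R) < t%:R by rewrite tq powR_gt0.
pose E : classical_sets.set R := [set tau : R |
    (fun n : nat => (s_rank (matmul_tensor R n))%:R : R) =O_\oo
    (fun n : nat => (n%:R : R) `^ tau)]%classic.
have Etau : E tau.
  apply/eqO_exP; exists t%:R => //; near=> n.
  have n1 : (1 < n)%N by near: n; exact: nbhs_infty_gt.
  rewrite !ger0_norm ?powR_ge0 //.
  have /andP[ltn len] := up_log_bounds q1 n1; set e := up_log q n in ltn len.
  have e0 : (0 < e)%N by rewrite up_log_gt0 q1.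
  have Sn := mm_support_rank_leq (mm_support_rank_exp e S) len len len.
  apply: (@le_trans _ _ ((t ^ e)%N%:R)); first by rewrite ler_nat s_rank_leq.
  rewrite natrX -(prednK e0) exprS ler_wpM2l ?ler0n //.
  rewrite tq -powR_mulrn ?powR_ge0 // -powRrM mulrC powRrM powR_mulrn ?(ltW q0) //.
  by rewrite ge0_ler_powR ?nnegrE ?exprn_ge0 ?ler0n // -natrX ler_nat ltnW.
(* If E had no lower bound, its infimum would be 0 by convention, and tau is
   nonnegative. *)
have [Elb|nElb] := pselect (has_lbound E); first exact: ge_inf.
rewrite /omega_s -/E inf_out // => -[_]; exact: nElb.
Unshelve. all: by end_near. Qed.

(** If LMN > 1, the cube of the restricted triangle tensor gives
    omega_s <= 3 log r / log LMN; if LMN = 1, the bound is 1 <= r. *)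
Lemma omega_s_rank_inequality (R : realType) D L M N :
    cc_commutative D -> (0 < L)%N -> (0 < M)%N -> (0 < N)%N -> realizes D L M N ->
  ((L * M * N)%N%:R : R) `^ (omega_s R / 3) <= (cc_rank D)%:R.
Proof.
move=> hcomm L0 M0 N0 DLMN; set q := (L * M * N)%N; set r := cc_rank D.
have r0 : (0 < r)%N.
  have [alpha _] := DLMN; rewrite /r /cc_rank; apply/card_gt0P.
  by exists (alpha (Ordinal L0, Ordinal M0)).
have := realizes_support_rank R[i] hcomm DLMN; rewrite -/r => S.
have [q1|q1] := ltnP 1 q; last first.
  have -> : q = 1%N by apply/eqP; rewrite eqn_leq q1 !muln_gt0 L0 M0.
  by rewrite powR1 ler1n.
have lnq0 : 0 < ln (q%:R : R) by rewrite ln_gt0 // ltr1n.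
have lnr0 : 0 <= ln (r%:R : R) by rewrite ln_ge0 // ler1n.
have q0 : (q%:R : R) != 0 by rewrite pnatr_eq0 -lt0n ltnW.
(* tau is chosen so that q^(tau/3) = r, that is q^tau = r^3. *)
pose tau : R := 3 * (ln r%:R / ln q%:R).
have tau0 : 0 <= tau by rewrite mulr_ge0 // divr_ge0 // ltW.
have rE : (q%:R : R) `^ (tau / 3) = r%:R.
  rewrite /tau mulrAC divff // mul1r /powR (negPf q0) divfK ?gt_eqF //.
  by rewrite lnK // posrE ltr0n.
rewrite -rE ler_powR ?ler1n 1?ltnW // ler_pM2r ?invr_gt0 //.
apply: (omega_s_le q1 (mm_support_rank_cube S)) => //.
rewrite natrX -rE -powR_mulrn ?powR_ge0 // -powRrM; congr (_ `^ _).
by rewrite divfK.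
Qed.

(** * Direct and symmetric powers *)

Section DirectPowerFacts.
Variables (C : coherent_configuration) (t : nat).

Lemma direct_power_commutative :
  cc_commutative C -> cc_commutative (direct_power C t).
Proof. by move=> hcomm I J K; apply: eq_bigr => h _; apply: hcomm. Qed.

Lemma direct_power_triangle (I J K : {ffun 'I_t -> ccIdx C}) :
  cc_triangle (C := direct_power C t) I J K <->
  forall j, cc_triangle (I j) (J j) (K j).
Proof.
split=> [[x [y [z []]]]|].
  rewrite !inE => /forallP xy /forallP yz /forallP zx j.
  by exists (x j), (y j), (z j).
move=> H.
have /boolp.choice[f fP] : forall j,
    exists u : ccPoint C * ccPoint C * ccPoint C,
    [/\ (u.1.1, u.1.2) \in ccR (I j), (u.1.2, u.2) \in ccR (J j)
      & (u.2, u.1.1) \in ccR (K j)].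
  by move=> j; have [x [y [z xyz]]] := H j; exists (x, y, z).
exists [ffun j => (f j).1.1], [ffun j => (f j).1.2], [ffun j => (f j).2].
by split; rewrite inE; apply/forallP => j /=; rewrite !ffunE; have [] := fP j.
Qed.

End DirectPowerFacts.

Lemma leq_ffact_expn a b : (a ^_ b <= a ^ b)%N.
Proof.
by elim: b => // b IH; rewrite ffactnSr expnSr leq_mul ?leq_subr.
Qed.

Section SymmetricPowerFacts.
Variables (s : nat) (D : coherent_configuration).
Let E := direct_power D s.

Lemma symmetric_power_commutative :
  cc_commutative D -> cc_commutative (symmetric_power s D).
Proof.
move=> hcomm O1 O2 O.
have /set0Pn[[x y] xyO] := sym_R_neq0 O.
have [I [xyI _]] := @ccR_partition E (x, y).
rewrite /= -(sym_R_coherent O1 O2 xyO) -(sym_R_coherent O2 O1 xyO).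
rewrite !(sym_intersection_sum _ _ xyI) exchange_big /=.
apply: eq_bigr => I2 _; apply: eq_bigr => I1 _.
exact: direct_power_commutative.
Qed.

Lemma symmetric_power_triangle (O1 O2 O3 : sym_idx s D) :
  cc_triangle (C := symmetric_power s D) O1 O2 O3 <->
  exists I J K, [/\ I \in val O1, J \in val O2, K \in val O3 &
    cc_triangle (C := E) I J K].
Proof.
split=> [[x [y [z []]]]|[I [J [K [IO JO KO [x [y [z [xy yz zx]]]]]]]]].
  move=> /bigcupP[I IO xy] /bigcupP[J JO yz] /bigcupP[K KO zx].
  by exists I, J, K; split=> //; exists x, y, z.
exists x, y, z; split; apply/bigcupP.
- by exists I.
- by exists J.
- by exists K.
Qed.

(** Every orbit contains a word that is sorted for a fixed ordering of the
    letters. *)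
Lemma card_sym_orbits_sorted (K : finType) n : #|K| = n.+1 ->
  (#|[set sym_orbit I | I in [set: {ffun 'I_s -> K}]]%SET| <= 'C(s + n, s))%N.
Proof.
move=> Kn; rewrite -card_sorted_tuples.
pose unrank (i : 'I_n.+1) : K := enum_val (cast_ord (esym Kn) i).
pose rank (x : K) : 'I_n.+1 := cast_ord Kn (enum_rank x).
have rankK : cancel rank unrank.
  by move=> x; rewrite /unrank /rank cast_ordK enum_rankK.
pose F (u : s.-tuple 'I_n.+1) := sym_orbit [ffun j => unrank (tnth u j)].
apply: leq_trans (leq_imset_card F _).
apply/subset_leq_card/fintype.subsetP => _ /imsetP[I _ ->].
pose u := [tuple rank (I j) | j < s].
pose v := [tuple of sort (fun i j : 'I_n.+1 => i <= j)%N u].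
have /tuple_permP[g vE] : perm_eq v u by rewrite perm_sort.
apply/imsetP; exists v.
  by rewrite inE sorted_map; apply: sort_sorted => i j; apply: leq_total.
rewrite /F; have -> : [ffun j => unrank (tnth v j)] = permute g I.
  apply/ffunP => j; rewrite !ffunE.
  have /val_inj -> : val v = val [tuple tnth u (g i) | i < s] by rewrite [LHS]vE.
  by rewrite !tnth_mktuple rankK.
by rewrite sym_orbit_permute.
Qed.

(** The orbits number at most C(s + rho - 1, s) <= (2 rho)^s / s!, with rho
    the rank of [D]. *)
Lemma rank_symmetric_power : (0 < s <= cc_rank D)%N ->
  (cc_rank (symmetric_power s D) * s`! <= (2 * cc_rank D) ^ s)%N.
Proof.
move=> /andP[s_gt0 s_le].
have Kn : #|ccIdx D| = (cc_rank D).-1.+1 by rewrite prednK // (leq_trans s_gt0).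
have le_bin : (cc_rank (symmetric_power s D) <= 'C(s + (cc_rank D).-1, s))%N.
  apply: leq_trans (card_sym_orbits_sorted Kn).
  by rewrite /cc_rank /= card_sig.
apply: (leq_trans (leq_mul le_bin (leqnn _))); rewrite bin_ffact.
apply: (leq_trans (leq_ffact_expn _ _)); rewrite leq_exp2r //.
by rewrite mul2n -addnn leq_add // leq_pred.
Qed.

End SymmetricPowerFacts.

(** * Realizing several copies of a matrix multiplication *)

Section Copies.

(** The direct sum of [s] copies of <L, M, N>.  When the dimensions are
    positive, the condition on triangles makes the maps injective, also in the
    index of the copy. *)
Definition realizes_copies (D : coherent_configuration) (s L M N : nat) : Prop :=
  exists (alpha : 'I_s -> 'I_L * 'I_M -> ccIdx D)
         (beta : 'I_s -> 'I_M * 'I_N -> ccIdx D)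
         (gamma : 'I_s -> 'I_N * 'I_L -> ccIdx D),
    forall s1 s2 s3 a a' b b' c c',
      cc_triangle (alpha s1 (a, b')) (beta s2 (b, c')) (gamma s3 (c, a')) <->
      [/\ s1 = s2 /\ s2 = s3, a = a', b = b' & c = c'].

(** If two entries had the same class, then the triangle through the first
    would also be one for the second. *)
Lemma realizes_of_triangles (D : coherent_configuration) L M N
    (alpha : 'I_L * 'I_M -> ccIdx D) (beta : 'I_M * 'I_N -> ccIdx D)
    (gamma : 'I_N * 'I_L -> ccIdx D) :
    (0 < L)%N -> (0 < M)%N -> (0 < N)%N ->
    (forall a a' b b' c c',
      cc_triangle (alpha (a, b')) (beta (b, c')) (gamma (c, a')) <->
      [/\ a = a', b = b' & c = c']) ->
  realizes D L M N.
Proof.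
move=> L0 M0 N0 abc; exists alpha, beta, gamma; split=> //.
- move=> [a1 b1] [a2 b2] e; pose c := Ordinal N0.
  have : cc_triangle (alpha (a1, b1)) (beta (b1, c)) (gamma (c, a1)) by apply/abc.
  by rewrite e => /abc[-> ->].
- move=> [b1 c1] [b2 c2] e; pose a := Ordinal L0.
  have : cc_triangle (alpha (a, b1)) (beta (b1, c1)) (gamma (c1, a)) by apply/abc.
  by rewrite e => /abc[_ -> ->].
- move=> [c1 a1] [c2 a2] e; pose b := Ordinal M0.
  have : cc_triangle (alpha (a1, b)) (beta (b, c1)) (gamma (c1, a1)) by apply/abc.
  by rewrite e => /abc[-> _ ->].
Qed.

(** Triangles never mix copies, so distinct copies use distinct classes. *)
Lemma realizes_copies_leq_rank D s L M N :
  (0 < L)%N -> (0 < M)%N -> (0 < N)%N -> realizes_copies D s L M N ->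
  (s <= cc_rank D)%N.
Proof.
move=> L0 M0 N0 [alpha [beta [gamma abc]]].
pose a := Ordinal L0; pose b := Ordinal M0; pose c := Ordinal N0.
rewrite -[leqLHS](card_ord s); apply: (@leq_card _ _ (fun i => alpha i (a, b))).
move=> i j /= e.
have : cc_triangle (alpha i (a, b)) (beta i (b, c)) (gamma i (c, a)) by apply/abc.
by rewrite e => /abc[[]].
Qed.

(** Copy j is used at coordinate j.  A triangle of orbits is a triangle of
    words permuted by some g1, g2, g3; coordinate by coordinate it involves the
    copies g1 j, g2 j and g3 j, which forces g1 = g2 = g3, and then the
    conditions on triangles of the single copies apply. *)
Lemma symmetric_power_realizes D s L M N :
    (0 < L)%N -> (0 < M)%N -> (0 < N)%N -> realizes_copies D s L M N ->
  realizes (symmetric_power s D) (L ^ s) (M ^ s) (N ^ s).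
Proof.
move=> L0 M0 N0 [alpha [beta [gamma abc]]].
have /boolp.choice[cls clsP] := @sym_idx_exists s D.
have [f f_inj] : exists f : forall n, 'I_(n ^ s) -> {ffun 'I_s -> 'I_n},
    forall n, injective (f n).
  have e n : (n ^ s = #|{ffun 'I_s -> 'I_n}|)%N by rewrite card_ffun !card_ord.
  exists (fun n a => enum_val (cast_ord (e n) a)) => n.
  exact: inj_comp enum_val_inj (@cast_ord_inj _ _ _).
pose al x := cls [ffun j => alpha j (f L x.1 j, f M x.2 j)].
pose be x := cls [ffun j => beta j (f M x.1 j, f N x.2 j)].
pose ga x := cls [ffun j => gamma j (f N x.1 j, f L x.2 j)].
apply: (@realizes_of_triangles (symmetric_power s D) _ _ _ al be ga);
  rewrite ?expn_gt0 ?L0 ?M0 ?N0 //.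
move=> a a' b b' c c'; split; last first.
  case=> <- <- <-; apply/symmetric_power_triangle.
  exists [ffun j => alpha j (f L a j, f M b j)],
    [ffun j => beta j (f M b j, f N c j)], [ffun j => gamma j (f N c j, f L a j)].
  split; rewrite ?clsP ?sym_orbit_refl //.
  by apply/direct_power_triangle => j; rewrite !ffunE; apply/abc.
case/symmetric_power_triangle => I [J [K []]]; rewrite !clsP.
move=> /sym_orbitP[g1 ->] /sym_orbitP[g2 ->] /sym_orbitP[g3 ->].
move=> /direct_power_triangle gP.
have {}gP j : [/\ g1 j = g2 j /\ g2 j = g3 j,
    f L a (g1 j) = f L a' (g3 j), f M b (g2 j) = f M b' (g1 j)
    & f N c (g3 j) = f N c' (g2 j)].
  by have := gP j; rewrite !ffunE /= => /abc.
split; apply: f_inj; apply/ffunP => j.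
- by have [[e1 e2]] := gP (g1^-1%g j); rewrite -e2 -e1 permKV.
- by have [[e1 e2]] := gP (g1^-1%g j); rewrite -e1 permKV.
- by have [[e1 e2]] := gP (g1^-1%g j); rewrite -e2 -e1 permKV.
Qed.

Lemma product_embedding t (d : 'I_t -> nat) L : (L <= \prod_j d j)%N ->
  exists f : 'I_L -> forall j, 'I_(d j),
    forall a a', (forall j, f a j = f a' j :> nat) -> a = a'.
Proof.
have -> : (\prod_j d j = #|{dffun forall j : 'I_t, 'I_(d j)}|)%N.
  by rewrite card_dep_ffun foldrE big_image; apply: eq_bigr => j _; rewrite card_ord.
move=> leL.
exists (fun a => enum_val (widen_ord leL a) : {dffun forall j : 'I_t, 'I_(d j)}).
move=> a a' e.
have /(congr1 val) /= aa' : widen_ord leL a = widen_ord leL a'.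
  by apply/enum_val_inj/ffunP => j; apply/val_inj/e.
exact: val_inj.
Qed.

(** The blocks of the t-th power of a realized direct sum are indexed by
    words; those in [S] are large enough to contain <L, M, N>. *)
Lemma direct_power_realizes_copies C k (l m n : 'I_k -> nat) t
    (S : {set {ffun 'I_t -> 'I_k}}) L M N :
    realizes_sum C l m n ->
    (forall I, I \in S -> [/\ (L <= \prod_j l (I j))%N, (M <= \prod_j m (I j))%N
                           & (N <= \prod_j n (I j))%N]) ->
  realizes_copies (direct_power C t) #|S| L M N.
Proof.
move=> [alpha [beta [gamma [_ _ _ abc]]]] SP.
pose I (s : 'I_#|S|) := enum_val s.
have embed (d : 'I_k -> nat) P : (forall J, J \in S -> (P <= \prod_j d (J j))%N) ->
    exists f : forall s : 'I_#|S|, 'I_P -> forall j, 'I_(d (I s j)),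
    forall s a a', (forall j, f s a j = f s a' j :> nat) -> a = a'.
  move=> dP; apply: (@fin_all_exists 'I_#|S|
    (fun s => 'I_P -> forall j, 'I_(d (I s j)))
    (fun s f => forall a a', (forall j, f a j = f a' j :> nat) -> a = a')) => s.
  apply: product_embedding.
  exact/dP/enum_valP.
have [f fP] := embed l L (fun J JS => let: And3 h _ _ := SP J JS in h).
have [g gP] := embed m M (fun J JS => let: And3 _ h _ := SP J JS in h).
have [h hP] := embed n N (fun J JS => let: And3 _ _ h := SP J JS in h).
exists (fun s x => [ffun j => alpha (I s j) (f s x.1 j, g s x.2 j)]),
  (fun s x => [ffun j => beta (I s j) (g s x.1 j, h s x.2 j)]),
  (fun s x => [ffun j => gamma (I s j) (h s x.1 j, f s x.2 j)]).
move=> s1 s2 s3 a a' b b' c c'; rewrite direct_power_triangle; split=> [H|].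
  have {}H j : [/\ I s1 j = I s2 j /\ I s2 j = I s3 j, f s1 a j = f s3 a' j :> nat,
      g s2 b j = g s1 b' j :> nat & h s3 c j = h s2 c' j :> nat].
    by have := H j; rewrite !ffunE /= => /abc.
  have e12 : s1 = s2 by apply/enum_val_inj/ffunP => j; have [[]] := H j.
  have e23 : s2 = s3 by apply/enum_val_inj/ffunP => j; have [[]] := H j.
  subst s2 s3; split=> //.
  - by apply: (fP s1) => j; have [_] := H j.
  - by apply: (gP s1) => j; have [_] := H j.
  - by apply: (hP s1) => j; have [_] := H j.
case=> -[<- <-] <- <- <- j; rewrite !ffunE /=.
exact/abc.
Qed.

End Copies.

(** * Counting: from copies to the bound on the sum *)

Lemma leq_bin_exp2 n m : ('C(n, m) <= 2 ^ n)%N.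
Proof.
elim: n m => [|n IH] [|m] //; first by rewrite bin0 expn_gt0.
by rewrite binS expnS mul2n -addnn leq_add.
Qed.

(** A weak form of Stirling's bound: s^s <= (2s)(2s-1)...(s+1), which is s!
    times a binomial coefficient at most 2^(2s). *)
Lemma expn_leq_fact s : (s ^ s <= 4 ^ s * s`!)%N.
Proof.
have le_ffact a b : (a ^ b <= (a + b) ^_ b)%N.
  elim: b => // b IH; rewrite addnS ffactSS expnS leq_mul //.
  by rewrite -addnS leq_addr.
apply: leq_trans (le_ffact s s) _.
have -> : (4 ^ s = 2 ^ (s + s))%N by rewrite addnn -mul2n expnM.
by rewrite -bin_ffact leq_mul2r leq_bin_exp2 orbT.
Qed.

(** With rho the rank of [D], the inequality for the s-th symmetric power gives
    (s (LMN)^(tau/3))^s <= s^s (2 rho)^s / s! <= (8 rho)^s. *)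
Lemma copies_bound (R : realType) (D : coherent_configuration) s L M N (tau : R) :
    (0 < L)%N -> (0 < M)%N -> (0 < N)%N -> (0 < s)%N -> realizes_copies D s L M N ->
    (forall L' M' N', (0 < L')%N -> (0 < M')%N -> (0 < N')%N ->
       realizes (symmetric_power s D) L' M' N' ->
       ((L' * M' * N')%N%:R : R) `^ (tau / 3)
         <= (cc_rank (symmetric_power s D))%:R) ->
  s%:R * ((L * M * N)%N%:R : R) `^ (tau / 3) <= (8 * cc_rank D)%N%:R.
Proof.
move=> L0 M0 N0 s0 copies ineq; set W := _ `^ _; set rho := cc_rank D.
have W0 : 0 <= W by apply: powR_ge0.
have s_le : (0 < s <= rho)%N by rewrite s0 (realizes_copies_leq_rank L0 M0 N0 copies).
have Ws : W ^+ s <= (cc_rank (symmetric_power s D))%:R.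
  have := ineq _ _ _ _ _ _ (symmetric_power_realizes L0 M0 N0 copies).
  rewrite !expn_gt0 L0 M0 N0 => /(_ isT isT isT); apply: le_trans.
  rewrite -!expnMn natrX -powR_mulrn ?powR_ge0 // -powR_mulrn ?ler0n //.
  by rewrite powRAC.
rewrite -(@ler_pXn2r _ s) ?nnegrE ?mulr_ge0 ?ler0n // exprMn.
apply: (@le_trans _ _ (s%:R ^+ s * (cc_rank (symmetric_power s D))%:R)).
  by rewrite ler_wpM2l // exprn_ge0 ?ler0n.
rewrite -!natrX -natrM ler_nat.
apply: (leq_trans (leq_mul (expn_leq_fact s) (leqnn _))).
have -> : (8 * rho = 4 * (2 * rho))%N by rewrite mulnA.
rewrite expnMn -mulnA (mulnC s`!).
by rewrite leq_mul2l rank_symmetric_power ?orbT.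
Qed.

(** If y = x / r > 1, then z = y^(1/(k+1)) > 1 and z^t grows at least linearly,
    so y^t grows at least like (t+1)^(k+1), too fast for a bound of the form
    B (t+1)^k. *)
Lemma le_of_power_growth (R : realType) (x r B : R) k :
    0 <= x -> 0 < r -> (forall t, (0 < t)%N -> x ^+ t <= B * t.+1%:R ^+ k * r ^+ t) ->
  x <= r.
Proof.
move=> x0 r0 xt; rewrite leNgt; apply/negP => rx.
pose y := x / r; have y1 : 1 < y by rewrite ltr_pdivlMr ?mul1r.
pose z := y `^ (k.+1%:R)^-1.
have zy : z ^+ k.+1 = y.
  rewrite -powR_mulrn ?powR_ge0 // -powRrM mulVf ?pnatr_eq0 // powRr1 //.
  by rewrite ltW // (lt_trans _ y1).
have z0 : 0 <= z by apply: powR_ge0.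
have z1 : 1 < z by rewrite -(@ltr_pXn2r _ k.+1) ?nnegrE ?ler01 // expr1n zy.
pose d := Num.min 1 (z - 1).
have d0 : 0 < d by rewrite lt_min ltr01 subr_gt0.
have bern t : d * t.+1%:R <= z ^+ t.
  elim: t => [|t IH]; first by rewrite mulr1 expr0 ge_min lexx.
  have d1 : d <= z - 1 by rewrite ge_min lexx orbT.
  have zt1 : 1 <= z ^+ t by rewrite exprn_ege1 // ltW.
  rewrite exprS -[z](subrK 1) mulrDl mul1r subrK -[t.+2%:R]natr1 mulrDr mulr1 addrC.
  by rewrite lerD // -[leLHS]mulr1 ler_pM // ltW.
have t_le t : (0 < t)%N -> d ^+ k.+1 * t.+1%:R <= B.
  move=> t_gt0; have tk : (0 : R) < t.+1%:R ^+ k by rewrite exprn_gt0 ?ltr0n.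
  rewrite -(ler_pM2r tk) -mulrA -exprS -exprMn.
  apply: (@le_trans _ _ (y ^+ t)).
    rewrite -zy exprAC lerXn2r ?nnegrE ?exprn_ge0 //.
    by rewrite mulr_ge0 ?ler0n // ltW.
  by rewrite /y expr_div_n ler_pdivrMr ?exprn_gt0 // xt.
have dk : 0 < d ^+ k.+1 by rewrite exprn_gt0.
(* The first t for which d^(k+1) (t+1) is sure to exceed B. *)
pose t := (Num.truncn (B / d ^+ k.+1)).+1.
have := t_le t isT; rewrite leNgt mulrC -ltr_pdivrMr // => /negP; apply.
apply: (lt_trans (truncnS_gt _)).
by rewrite ltr_nat.
Qed.

Section LetterCounts.
Variables (k t : nat).

(** The counts are at most [t], so they are stored in a finite type: the number
    of possible values, (t+1)^k, is what matters. *)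
Definition letter_counts (I : {ffun 'I_t -> 'I_k}) : {ffun 'I_k -> 'I_t.+1} :=
  [ffun i => inord #|[pred j | I j == i]|].

Lemma prod_letter_counts (I J : {ffun 'I_t -> 'I_k}) (d : 'I_k -> nat) :
  letter_counts I = letter_counts J -> (\prod_j d (I j) = \prod_j d (J j))%N.
Proof.
have prodE (H : {ffun 'I_t -> 'I_k}) :
    (\prod_j d (H j) = \prod_i d i ^ letter_counts H i)%N.
  rewrite (partition_big H xpredT) //=; apply: eq_bigr => i _.
  rewrite ffunE inordK; last by rewrite ltnS -[leqRHS](card_ord t) max_card.
  rewrite -prod_nat_const; apply: eq_big => [j|j /eqP-> //].
  by rewrite inE.
by move=> IJ; rewrite !prodE IJ.
Qed.

End LetterCounts.

(** Expanding the t-th power of the sum gives one term for each word; words with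
    the same counts give equal terms, the copies to which [copies_bound]
    applies. *)
Lemma sum_bound (R : realType) (C : coherent_configuration) (k : nat)
    (l m n : 'I_k -> nat) (tau : R) :
    (forall i, (0 < l i)%N) -> (forall i, (0 < m i)%N) -> (forall i, (0 < n i)%N) ->
    (0 < cc_rank C)%N -> realizes_sum C l m n ->
    rank_inequalities (symmetric_powers_of_direct_powers C) tau ->
  \sum_(i < k) ((l i * m i * n i)%N%:R : R) `^ (tau / 3) <= (cc_rank C)%:R.
Proof.
move=> l0 m0 n0 C0 hreal ineq.
apply: (@le_of_power_growth _ _ _ 8 k); rewrite ?ltr0n //.
  by apply: sumr_ge0 => i _; apply: powR_ge0.
move=> t t0; pose f (a : nat) : R := a%:R `^ (tau / 3).
have f_prod (g : 'I_t -> nat) : \prod_j f (g j) = f (\prod_j g j)%N.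
  apply/esym/(big_morph f) => [a b|]; last by rewrite /f powR1.
  by rewrite /f natrM powRM ?ler0n.
rewrite -[t in X in X <= _]card_ord -prodr_const bigA_distr_bigA /=.
rewrite (partition_big (@letter_counts k t) xpredT) //=.
apply: (@le_trans _ _ (\sum_(c : {ffun 'I_k -> 'I_t.+1}) 8 * (cc_rank C)%:R ^+ t)).
  2: by rewrite sumr_const card_ffun !card_ord -[leLHS]mulr_natr natrX mulrAC.
apply: ler_sum => c _; 
pose S : {set {ffun 'I_t -> 'I_k}} := [set I | letter_counts I == c]%SET.
have [/eqP S0|[I0 I0S]] := set_0Vmem S.
  rewrite big_pred0 ?mulr_ge0 ?exprn_ge0 ?ler0n //.
  by move=> I; move/eqP/setP/(_ I): S0; rewrite !inE.
have SE I : I \in S -> letter_counts I = letter_counts I0.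
  by move: I0S; rewrite !inE => /eqP-> /eqP.
pose L := (\prod_j l (I0 j))%N; pose M := (\prod_j m (I0 j))%N.
pose N := (\prod_j n (I0 j))%N.
have copies : realizes_copies (direct_power C t) #|S| L M N.
  apply: direct_power_realizes_copies hreal _ => I /SE e.
  by rewrite /L /M /N !(prod_letter_counts _ e).
have s0 : (0 < #|S|)%N by apply/card_gt0P; exists I0.
have L0 : (0 < L)%N by apply: prodn_gt0.
have M0 : (0 < M)%N by apply: prodn_gt0.
have N0 : (0 < N)%N by apply: prodn_gt0.
have := copies_bound L0 M0 N0 s0 copies (tau := tau).
have -> : cc_rank (direct_power C t) = (cc_rank C ^ t)%N.
  by rewrite /cc_rank /= card_ffun card_ord.
rewrite (natrM _ 8) natrX => H; apply: le_trans (H _); last first.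
  move=> L' M' N' L'0 M'0 N'0; apply: ineq => //.
  by exists #|S|, t.
rewrite (eq_bigr (fun=> f (L * M * N)%N)); last first.
  move=> I; have := SE I; rewrite inE => e /e{}e.
  by rewrite f_prod !big_split /= !(prod_letter_counts _ e).
rewrite sumr_const mulr_natl.
by rewrite (eq_card (B := S)) // => I; rewrite !inE.
Qed.

Theorem theorem5p5 (R : realType) (C : coherent_configuration) (r : nat)
    (hcomm : cc_commutative C) (hrank : cc_rank C = r)
    (k : nat) (hk : (1 <= k)%N) (l m n : 'I_k -> nat)
    (hl : forall i, (0 < l i)%N) (hm : forall i, (0 < m i)%N)
    (hn : forall i, (0 < n i)%N)
    (hreal : realizes_sum C l m n) :
  proves_bound (symmetric_powers_of_direct_powers C)
    (fun tau : R =>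
       \sum_(i < k) ((l i * m i * n i)%N%:R : R) `^ (tau / 3) <= r%:R).
Proof.
have C0 : (0 < cc_rank C)%N.
  have [alpha _] := hreal; apply/card_gt0P; pose i := Ordinal hk.
  by exists (alpha i (Ordinal (hl i), Ordinal (hm i))).
have comm D : symmetric_powers_of_direct_powers C D -> cc_commutative D.
  move=> [s [t [_ _ ->]]].
  exact/symmetric_power_commutative/direct_power_commutative.
have bound tau : rank_inequalities (symmetric_powers_of_direct_powers C) tau ->
    \sum_(i < k) ((l i * m i * n i)%N%:R : R) `^ (tau / 3) <= r%:R.
  by rewrite -hrank; apply: sum_bound.
split=> //; apply: bound => D /comm D_comm L M N L0 M0 N0.
exact: omega_s_rank_inequality.
Qed.
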